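(* Let $A:D(A)\subseteq\mathcal H\to\mathcal H$ be a self-adjoint operator on the Hilbert space $\mathcal H$, and let $\mathcal H_+$ be $D(A)$ with the graph inner product. Let $\mathfrak h$ be a Hilbert space with inner product $[\cdot,\cdot]$, and let $\tau:\mathcal H_+\to\mathfrak h$ be a bounded linear surjective map such that $\mathcal N:=\mathrm{Ker}(\tau)$ is dense in $\mathcal H$. Let $A_{\mathcal N}$ be the restriction of $A$ to $\mathcal N$. For $z\in\rho(A)$ let $R(z):=(-A+z)^{-1}:\mathcal H\to\mathcal H_+$ and $G(z):=(\tau R(\bar z))^*:\mathfrak h\to\mathcal H$, and set $$R:=R(i),\qquad G:=G(-i),\qquad G_*:=\tfrac12\,(G(i)+G(-i)).$$ Then: (1) The adjoint $A_{\mathcal N}^*$ of $A_{\mathcal N}$ in $\mathcal H$ is given by $$D(A_{\mathcal N}^* )=\{\phi\in\mathcal H:\ \phi=\phi_*+G_*\zeta_\phi,\ \phi_*\in D(A),\ \zeta_\phi\in\mathfrak h\},\qquad A_{\mathcal N}^*\phi=A\phi_*+RG\,\zeta_\phi .$$ (2) Defining $$\gamma_1:D(A_{\mathcal N}^* )\to\mathfrak h,\quad \gamma_1\phi:=-\tau\phi_*,\qquad \gamma_2:D(A_{\mathcal N}^* )\to\mathfrak h,\quad \gamma_2\phi:=\zeta_\phi,$$ the triple $\{\mathfrak h,\gamma_1,\gamma_2\}$ is a boundary triple for $A_{\mathcal N}^*$. (3) The Weyl function of $A_{\mathcal N}$ corresponding to this boundary triple is $$\Gamma:\rho(A)\to\mathsf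 B(\mathfrak h),\qquad \Gamma(z)=\tau\,(G_*-G(z)).$$
   Context: Hilbert spaces are complex. $\langle\cdot,\cdot\rangle$ is the inner product of $\mathcal H$. $\mathcal H_+$ denotes the Hilbert space given by the set $D(A)$ with inner product $\langle\phi_1,\phi_2\rangle_+:=\langle A\phi_1,A\phi_2\rangle+\langle\phi_1,\phi_2\rangle$. $\rho(A)$ is the resolvent set of $A$, and $\mathsf B(\mathfrak h)$ is the space of bounded linear operators on $\mathfrak h$. The adjoint $(\tau R(\bar z))^*$ is that of the bounded operator $\tau R(\bar z):\mathcal H\to\mathfrak h$. In this setting $D(A)\cap\mathrm{Ran}(G_* )=\{0\}$ and $G_*$ is injective, so that $\phi_*$ and $\zeta_\phi$ in the decomposition $\phi=\phi_*+G_*\zeta_\phi$ are uniquely determined by $\phi$; moreover $\mathrm{Ran}(G_*-G(z))\subseteq D(A)$, so that $\tau(G_*-G(z))$ is defined. Boundary triple: for a densely defined closed symmetric operator $S$ in $\mathcal H$ with equal defect indices, a boundary triple for $S^*$ is a triple $\{\mathfrak h,\gamma_1,\gamma_2\}$ where $\mathfrak h$ is a Hilbert space with inner product $[\cdot,\cdot]$ and $\gamma_1,\gamma_2:D(S^* )\to\mathfrak h$ are linear maps such that $\phi\mapsto(\gamma_1\phi,\gamma_2\phi)$ is surjective from $D(S^* )$ onto $\mathfrak h\oplus\mathfrak h$ and $$\langle S^*\phi,\psi\rangle-\langle\phi,S^*\psi\rangle=[\gamma_1\phi,\gamma_2\psi]-[\gamma_2\phi,\gamma_1\psi]\qquad\text{for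 all }\phi,\psi\in D(S^* ).$$ Weyl function: given a boundary triple $\{\mathfrak h,\gamma_1,\gamma_2\}$ for $S^*$, let $A$ denote the self-adjoint extension of $S$ obtained by restricting $S^*$ to $\{\phi\in D(S^* ):\gamma_2\phi=0\}$ (for the triple in the claim, this is the given operator $A$). The Weyl function of $S$ corresponding to the triple is the unique map $\Gamma:\rho(A)\to\mathsf B(\mathfrak h)$ such that, for every $z\in\rho(A)$, $\Gamma(z)\gamma_2\phi_z=\gamma_1\phi_z$ for all $\phi_z\in\mathrm{Ker}(-S^*+z)$. *)

(* Defs.v *)
From HB Require Import structures.
From mathcomp Require Import all_boot all_order all_algebra sesquilinear.
From mathcomp Require Import complex.
From mathcomp Require Import boolp classical_sets functions cardinality reals.
From mathcomp Require Import topology normedtype.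

Set Implicit Arguments.
Unset Strict Implicit.
Unset Printing Implicit Defensive.

Import Order.TTheory GRing.Theory Num.Theory.
Import numFieldNormedType.Exports.

Local Open Scope classical_set_scope.
Local Open Scope ring_scope.

(* Complex Hilbert spaces: complete normed spaces over R[i] whose norm comes
   from an inner product.  As everywhere in MathComp, the inner product is
   linear in its first argument and conjugate-linear in its second one. *)
HB.mixin Record isHilbert (R : realType) V of CompleteNormedModule R[i] V := {
  hdot : {dot V for (@Num.conj R[i])} ;
  hdot_norm : forall x : V, `|x| ^+ 2 = hdot x x
}.

#[short(type="hilbertType")]
HB.structure Definition Hilbert (R : realType) :=
  {V of CompleteNormedModule R[i] V & isHilbert R V}.

Notation "''[' u , v ]" := (hdot u%R v%R) : ring_scope.

(* A partially defined operator is a domain together with a function whose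
   values outside of the domain are irrelevant. *)
Record pop (E F : Type) := Pop { dom : set E ; app :> E -> F }.

Definition op_eq (E F : Type) (S T : pop E F) : Prop :=
  dom S = dom T /\ forall x, dom S x -> S x = T x.

Definition restrict (E F : Type) (T : pop E F) (D : set E) : pop E F :=
  Pop (dom T `&` D) T.

Definition linear_on (K : pzRingType) (E F : lmodType K) (D : set E)
    (f : E -> F) : Prop :=
  [/\ D 0,
      forall (a : K) x y, D x -> D y -> D (a *: x + y)
    & forall (a : K) x y, D x -> D y -> f (a *: x + y) = a *: f x + f y].

Section Operators.
Variables (R : realType) (H : hilbertType R).
Local Notation C := R[i].
Implicit Types (T S A : pop H H) (z : C).

Definition bounded_operator (E F : hilbertType R) (B : E -> F) : Prop :=
  linear B /\ continuous B.

(* Adjoint of an everywhere defined bounded operator. *)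
Definition badjoint (E F : hilbertType R) (B : E -> F) (y : F) : E :=
  xget 0 [set u | forall x, '[B x, y] = '[x, u]].

(* Adjoint of a densely defined operator. *)
Definition is_adjoint_value T (y u : H) : Prop :=
  forall x, dom T x -> '[T x, y] = '[x, u].

Definition adjoint T : pop H H :=
  Pop [set y | exists u, is_adjoint_value T y u]
      (fun y => xget 0 [set u | is_adjoint_value T y u]).

Definition linear_op T : Prop := linear_on (dom T) T.

Definition densely_defined T : Prop := dense (dom T).

Definition closed_op T : Prop :=
  closed [set p : H * H | dom T p.1 /\ p.2 = T p.1].

Definition symmetric_op T : Prop :=
  forall x y, dom T x -> dom T y -> '[T x, y] = '[x, T y].

Definition self_adjoint T : Prop :=
  [/\ linear_op T, densely_defined T & op_eq T (adjoint T)].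

(* Ker(-T + z) *)
Definition kernel_at T z : set H :=
  [set x | dom T x /\ - T x + z *: x = 0].

Definition resolvent_set T : set C :=
  [set z | exists B : H -> H,
     [/\ bounded_operator B,
         forall y, dom T (B y) /\ - T (B y) + z *: B y = y
       & forall x, dom T x -> B (- T x + z *: x) = x]].

(* (-T + z)^-1 *)
Definition resolvent T z (y : H) : H :=
  xget 0 [set x | dom T x /\ - T x + z *: x = y].

(* Inner product and norm of the space H_+. *)
Definition graph_dot T (x y : H) : C := '[T x, T y] + '[x, y].

Definition graph_norm T (x : H) : C := sqrtC (graph_dot T x x).

Definition graph_bounded (F : hilbertType R) T (f : H -> F) : Prop :=
  exists M : C, forall x, dom T x -> `|f x| <= M * graph_norm T x.

Definition orthonormal_basis (W B : set H) : Prop :=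
  [/\ B `<=` W,
      forall x y, B x -> B y -> '[x, y] = (x == y)%:R
    & forall x, W x -> (forall b, B b -> '[x, b] = 0) -> x = 0].

(* Equality of Hilbert dimensions, which may be arbitrary cardinals. *)
Definition same_hilbert_dim (V W : set H) : Prop :=
  exists B1 B2 : set H,
    [/\ orthonormal_basis V B1, orthonormal_basis W B2 & (B1 #= B2)%card].

Definition equal_defect_indices S : Prop :=
  same_hilbert_dim (kernel_at (adjoint S) 'i) (kernel_at (adjoint S) (- 'i)).

Section BoundaryTriple.
Variable h : hilbertType R.

Definition boundary_triple S (g1 g2 : H -> h) : Prop :=
  [/\ [/\ linear_op S, densely_defined S, closed_op S, symmetric_op S
        & equal_defect_indices S],
      linear_on (dom (adjoint S)) g1 /\ linear_on (dom (adjoint S)) g2,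
      forall a b : h, exists phi, [/\ dom (adjoint S) phi, g1 phi = a & g2 phi = b]
    & forall phi psi, dom (adjoint S) phi -> dom (adjoint S) psi ->
        '[adjoint S phi, psi] - '[phi, adjoint S psi]
        = '[g1 phi, g2 psi] - '[g2 phi, g1 psi]].

Definition triple_extension S (g2 : H -> h) : pop H H :=
  restrict (adjoint S) [set phi | g2 phi = 0].

Definition weyl_property S (g1 g2 : H -> h) (Gamma : C -> h -> h) : Prop :=
  forall z, resolvent_set (triple_extension S g2) z ->
    bounded_operator (Gamma z) /\
    forall phi, kernel_at (adjoint S) z phi -> Gamma z (g2 phi) = g1 phi.

Definition is_weyl_function S (g1 g2 : H -> h) (Gamma : C -> h -> h) : Prop :=
  weyl_property S g1 g2 Gamma /\
  forall Gamma', weyl_property S g1 g2 Gamma' ->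
    forall z, resolvent_set (triple_extension S g2) z -> Gamma' z = Gamma z.

End BoundaryTriple.

Section Setting.
Variables (h : hilbertType R) (A : pop H H) (tau : H -> h).

Definition ker_tau : set H := [set x | dom A x /\ tau x = 0].

Definition A_N : pop H H := restrict A ker_tau.

Definition G_ (z : C) : h -> H := badjoint (fun y => tau (resolvent A z^* y)).

Definition G_star (zeta : h) : H := 2^-1 *: (G_ 'i zeta + G_ (- 'i) zeta).

(* The components of phi = phi_* + G_* zeta, with phi_* in D(A). *)
Definition zeta_part (phi : H) : h :=
  xget 0 [set zeta | dom A (phi - G_star zeta)].

Definition star_part (phi : H) : H := phi - G_star (zeta_part phi).

Definition gamma1 (phi : H) : h := - tau (star_part phi).

Definition gamma2 (phi : H) : h := zeta_part phi.

Definition weyl_tau (z : C) (zeta : h) : h := tau (G_star zeta - G_ z zeta).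

End Setting.

End Operators.

(* Main.v *)
(* For tau_star := R(i) G(-i), a map from h to D(A), one has
     G(i) = - A tau_star - i tau_star,   G(-i) = - A tau_star + i tau_star,
     G_* = - A tau_star,
   and tau_star is the adjoint of tau for the graph inner product:
     [tau x, zeta] = <A x, A tau_star zeta> + <x, tau_star zeta>  for x in D(A).
   Hence G_* zeta lies in the domain of A_N^*, which sends it to tau_star zeta,
   and the Green identity is this formula together with the symmetry of A.

   Conversely, if phi is in the domain of A_N^*, solving
   (- A + i) phi_0 = (- A_N^* + i) phi leaves phi - phi_0 orthogonal to the
   kernel of tau R(-i).  This operator is bounded and onto h, so by uniform
   boundedness its adjoint G(i) is bounded below and has closed range, and
   phi - phi_0 = G(i) zeta for some zeta.

   Since G(z) zeta and G_* zeta differ by an element of D(A), the kernel of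
   - A_N^* + z is the range of G(z), which gives the Weyl function.  The isometry
   G(i) zeta |-> G(-i) zeta identifies the two defect spaces. *)

From HB Require Import structures.
Require Import Defs.
From mathcomp Require Import all_boot all_order all_algebra sesquilinear complex.
From mathcomp Require Import boolp classical_sets functions cardinality reals.
From mathcomp Require Import topology normedtype.
From mathcomp Require Import ring lra.

Set Implicit Arguments.
Unset Strict Implicit.
Unset Printing Implicit Defensive.

Import Order.TTheory GRing.Theory Num.Theory ComplexField Normc.
Import numFieldNormedType.Exports.

Local Open Scope classical_set_scope.
Local Open Scope complex_scope.
Local Open Scope ring_scope.

(** * Inner products *)

Lemma normc_ge0 (R : realType) (z : R[i]) : 0 <= normc z.
Proof. by case: z => a b; exact: sqrtr_ge0. Qed.

Lemma normc_real (R : realType) (r : R) : normc r%:C = `|r|.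
Proof. by rewrite /= expr0n/= addr0 sqrtr_sqr. Qed.

Section InnerProduct.
Context {R : realType} {E : hilbertType R}.
Implicit Types (x y z : E) (a : R[i]).

Lemma hdotDl x y z : '[x + y, z] = '[x, z] + '[y, z].
Proof. exact: linearDl. Qed.

Lemma hdotDr x y z : '[z, x + y] = '[z, x] + '[z, y].
Proof. exact: linearDr. Qed.

Lemma hdotNl x y : '[- x, y] = - '[x, y].
Proof. exact: linearNl. Qed.

Lemma hdotNr x y : '[x, - y] = - '[x, y].
Proof. exact: linearNr. Qed.

Lemma hdotBl x y z : '[x - y, z] = '[x, z] - '[y, z].
Proof. exact: linearBl. Qed.

Lemma hdotBr x y z : '[z, x - y] = '[z, x] - '[z, y].
Proof. exact: linearBr. Qed.

Lemma hdotZl a x y : '[a *: x, y] = a * '[x, y].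
Proof. exact: linearZl_LR. Qed.

Lemma hdotZr a x y : '[x, a *: y] = Num.conj a * '[x, y].
Proof. exact: linearZr_LR. Qed.

Lemma hdot0l x : '[0, x] = 0.
Proof. exact: linear0l. Qed.

Lemma hdot0r x : '[x, 0] = 0.
Proof. exact: linear0r. Qed.

Lemma hdotC x y : '[x, y] = Num.conj '[y, x].
Proof. by rewrite [LHS]hermC expr0 mul1r. Qed.

(** The norm of [E] takes values in [R[i]]; its real part keeps all estimates in the ordered field
    [R]. *)
Definition hnorm x : R := complex.Re `|x|.

Lemma normE x : `|x| = (hnorm x)%:C.
Proof. by rewrite /hnorm RRe_real// normr_real. Qed.

Lemma hnorm_ge0 x : 0 <= hnorm x.
Proof. by rewrite -ler0c -normE. Qed.

Lemma hnorm0 : hnorm 0 = 0.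
Proof. by apply: complexI; rewrite -normE normr0. Qed.

Lemma hnorm_eq0 x : hnorm x = 0 -> x = 0.
Proof. by move=> x0; apply/eqP; rewrite -normr_eq0 normE x0. Qed.

Lemma ler_hnormD x y : hnorm (x + y) <= hnorm x + hnorm y.
Proof. by rewrite -lecR rmorphD/= -!normE ler_normD. Qed.

Lemma hnorm_opp x : hnorm (- x) = hnorm x.
Proof. by apply: complexI; rewrite -!normE normrN. Qed.

Lemma hnorm_distC x y : hnorm (x - y) = hnorm (y - x).
Proof. by rewrite -hnorm_opp opprB. Qed.

Lemma hnormZ a x : hnorm (a *: x) = normc a * hnorm x.
Proof. by apply: complexI; rewrite -normE normrZ rmorphM/= -normE. Qed.

Lemma hdotxx x : '[x, x] = (hnorm x ^+ 2)%:C.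
Proof. by rewrite -hdot_norm normE rmorphXn. Qed.

Lemma hdotxx_eq0 x : '[x, x] = 0 -> x = 0.
Proof.
rewrite hdotxx => /complexI/eqP; rewrite sqrf_eq0 => /eqP; exact: hnorm_eq0.
Qed.

Lemma hdot_extr x y : (forall z, '[z, x] = '[z, y]) -> x = y.
Proof.
move=> xy; apply/eqP; rewrite -subr_eq0; apply/eqP/hdotxx_eq0.
by rewrite hdotBr xy subrr.
Qed.

Lemma hdot_extl x y : (forall z, '[x, z] = '[y, z]) -> x = y.
Proof. by move=> xy; apply: hdot_extr => z; rewrite hdotC xy -hdotC. Qed.

Lemma hdot_eq0C x y : '[x, y] = 0 -> '[y, x] = 0.
Proof. by move=> xy; rewrite hdotC xy rmorph0. Qed.

Lemma hnormD_orth x y : '[x, y] = 0 ->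
  hnorm (x + y) ^+ 2 = hnorm x ^+ 2 + hnorm y ^+ 2.
Proof.
move=> xy; apply: complexI; rewrite rmorphD/= -!hdotxx.
by rewrite hdotDl !hdotDr xy (hdot_eq0C xy) addr0 add0r.
Qed.

Lemma parallelogram x y :
  hnorm (x + y) ^+ 2 + hnorm (x - y) ^+ 2 = 2 * (hnorm x ^+ 2 + hnorm y ^+ 2).
Proof.
apply: complexI; rewrite rmorphM !rmorphD/= -!hdotxx.
by rewrite !(hdotDl, hdotDr, hdotBl, hdotBr, hdotNl, hdotNr); ring.
Qed.

Lemma hdot_proj_orth x y : '[x - ('[x, y] / '[y, y]) *: y, y] = 0.
Proof.
have [->|y0] := eqVneq y 0; first by rewrite hdot0r.
rewrite hdotBl hdotZl divfK ?subrr//.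
by apply: contra_neq y0; exact: hdotxx_eq0.
Qed.

(** Pythagoras for the residual of [x] along [y]. The factor [hnorm y ^+ 2] clears the denominator,
    so the identity includes [y = 0]; it serves both Cauchy-Schwarz and the nearest-point
    argument. *)
Lemma hnorm_proj x y :
  hnorm y ^+ 2 * hnorm (x - ('[x, y] / '[y, y]) *: y) ^+ 2 =
  hnorm x ^+ 2 * hnorm y ^+ 2 - normc '[x, y] ^+ 2.
Proof.
have [->|y0] := eqVneq y 0.
  by rewrite hdot0r hnorm0 normc0 expr0n/= mulr0 mul0r subrr.
have yy0 : hnorm y != 0 by apply: contra_neq y0; exact: hnorm_eq0.
pose a := '[x, y] / '[y, y].
have := @hnormD_orth (x - a *: y) (a *: y); rewrite {}/a.
rewrite hdotZr hdot_proj_orth mulr0 subrK => /(_ erefl) ->.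
rewrite hnormZ normcM normcV exprMn exprMn hdotxx normc_real.
rewrite exprVn -normrX ger0_norm ?exprn_ge0 ?hnorm_ge0//.
by field; rewrite yy0.
Qed.

Lemma cauchy_schwarz x y : normc '[x, y] <= hnorm x * hnorm y.
Proof.
rewrite -(@ler_pXn2r _ 2)// ?nnegrE ?mulr_ge0 ?hnorm_ge0 ?normc_ge0//.
by rewrite exprMn -subr_ge0 -hnorm_proj mulr_ge0// exprn_ge0// hnorm_ge0.
Qed.

End InnerProduct.

(** * Projection and Riesz representation *)

Lemma expr2V_lt (R : realType) (e : R) : 0 < e -> exists n, 2^-1 ^+ n < e.
Proof.
move=> e0; exists (Num.truncn e^-1).+1.
rewrite exprVn -ltf_pV2 ?posrE ?invr_gt0 ?exprn_gt0// invrK.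
rewrite (lt_trans (truncnS_gt _))// -natrX ltr_nat.
exact: ltn_expl.
Qed.

Lemma le_of_le_expr2V (R : realType) (a b c : R) :
  (forall n, a <= b + c * 2^-1 ^+ n) -> a <= b.
Proof.
move=> abc; rewrite leNgt; apply/negP => ba.
have c0 : 0 < c by have := abc 0%N; rewrite expr0; lra.
have [n nlt] := @expr2V_lt _ ((a - b) / c) ltac:(by rewrite divr_gt0// subr_gt0).
have := abc n; rewrite leNgt => /negP; apply.
by rewrite -ltrBrDl mulrC -ltr_pdivlMr.
Qed.

Section Completeness.
Context {R : realType}.

(** The rate passes to the limit unchanged: [l - x n] splits at a late index into a part of norm at
    most [eps n] and a part below [2^-1 ^+ k], for every [k]. *)
Lemma cauchy_hnorm_cvg (E : hilbertType R) (x : nat -> E) (eps : nat -> R) :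
  (forall n, eps n <= 2^-1 ^+ n) ->
  (forall n m, (n <= m)%N -> hnorm (x m - x n) <= eps n) ->
  exists l, forall n, hnorm (l - x n) <= eps n.
Proof.
move=> eps2 xC.
have /cvg_ex[l /cvgrPdist_lt xl] : cvg (x @ \oo).
  suff : cauchy (x @ \oo) by exact: cauchy_cvg.
  suff : cauchy_ex (x @ \oo) by exact: cauchy_exP.
  move=> e e0; rewrite /fmapE -ball_normE /=.
  have er : e = (complex.Re e)%:C by rewrite RRe_real// gtr0_real.
  move: e0; rewrite er (ltcR 0) => e0.
  have [N Ne] := expr2V_lt e0.
  exists (x N), N => // n /= Nn; rewrite normE ltcR hnorm_distC.
  exact: le_lt_trans (xC _ _ Nn) (le_lt_trans (eps2 N) Ne).
exists l => n; apply: (@le_of_le_expr2V _ _ _ 1) => k; rewrite mul1r.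
have [|N _ /(_ (maxn N n)) H] := xl (2^-1 ^+ k)%:C.
  by rewrite (ltcR 0) exprn_gt0 ?invr_gt0.
have -> : l - x n = (x (maxn N n) - x n) + (l - x (maxn N n)).
  by rewrite [RHS]addrC addrA subrK.
rewrite (le_trans (ler_hnormD _ _))// lerD//.
  by apply: xC; rewrite leq_maxr.
by apply: ltW; rewrite -ltcR -normE; apply: H; rewrite /= leq_maxl.
Qed.

Definition hclosed (E : hilbertType R) (W : set E) :=
  forall x, (forall e : R, 0 < e -> exists2 w, W w & hnorm (x - w) < e) -> W x.

Definition is_subspace (E : hilbertType R) (W : set E) :=
  W 0 /\ forall (a : R[i]) x y, W x -> W y -> W (a *: x + y).

Lemma subspaceZ (E : hilbertType R) (W : set E) a x :
  is_subspace W -> W x -> W (a *: x).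
Proof. by case=> W0 WD Wx; rewrite -[_ *: _]addr0; exact: WD. Qed.

Lemma subspaceD (E : hilbertType R) (W : set E) x y :
  is_subspace W -> W x -> W y -> W (x + y).
Proof. by case=> W0 WD Wx Wy; rewrite -[x]scale1r; exact: WD. Qed.

Lemma subspaceN (E : hilbertType R) (W : set E) x :
  is_subspace W -> W x -> W (- x).
Proof. by move=> sW Wx; rewrite -scaleN1r; exact: subspaceZ. Qed.

Lemma subspaceB (E : hilbertType R) (W : set E) x y :
  is_subspace W -> W x -> W y -> W (x - y).
Proof. by move=> sW Wx Wy; apply: subspaceD => //; exact: subspaceN. Qed.

(** Subtracting from [v] its component along a nonzero [w] lowers the squared norm by |<v, w>|^2 /
    |w|^2, which minimality forces to be zero. *)
Lemma nearest_point_orth (E : hilbertType R) (W : set E) (v : E) : is_subspace W ->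
  (forall w, W w -> hnorm v <= hnorm (v - w)) -> forall w, W w -> '[v, w] = 0.
Proof.
move=> sW vmin w Ww.
have := vmin _ (subspaceZ ('[v, w] / '[w, w]) sW Ww).
rewrite -(@ler_pXn2r _ 2)// ?nnegrE ?hnorm_ge0// => H.
have := ler_wpM2l (exprn_ge0 2 (hnorm_ge0 w)) H.
rewrite hnorm_proj => {}H.
apply: eq0_normc; apply/eqP; rewrite -sqrf_eq0 eq_le sqr_ge0 andbT.
by move: H; rewrite mulrC; lra.
Qed.

(** By the parallelogram law a sequence in [W] that nearly minimises the distance to [y] is Cauchy;
    its limit is a nearest point. *)
Lemma projection (E : hilbertType R) (W : set E) (y : E) :
  is_subspace W -> hclosed W ->
  exists2 w, W w & forall u, W u -> '[y - w, u] = 0.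
Proof.
move=> sW cW; have W0 := sW.1.
pose D := [set hnorm (y - w) | w in W].
have D0 : D !=set0 by exists (hnorm (y - 0)), 0.
have Dlb : lbound D 0 by move=> _ [w _ <-]; exact: hnorm_ge0.
have hD : has_inf D by split => //; exists 0.
pose d := inf D.
have d0 : 0 <= d by exact: lb_le_inf.
have dmin w : W w -> d <= hnorm (y - w).
  by move=> Ww; apply: ge_inf; [exists 0|exists w].
(* The parallelogram law bounds |w m - w n|^2 by 4 (d + eta n)^2 - 4 d^2, hence by 8 (d + 1) eta n
   because eta n <= 1. The choice of [eta] makes this the square of 2^-n. *)
pose eta n : R := 4^-1 ^+ n / (8 * (d + 1)).
have eta0 n : 0 < eta n by rewrite divr_gt0 ?exprn_gt0 ?invr_gt0 ?mulr_gt0//; lra.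
have /choice[w Hw] n : exists w, W w /\ hnorm (y - w) < d + eta n.
  have [_ [w Ww <-] lt] := inf_adherent (eta0 n) hD.
  by exists w.
have eta_le n m : (n <= m)%N -> eta m <= eta n.
  move=> nm; rewrite /eta ler_pM2r ?invr_gt0 ?mulr_gt0//; last lra.
  by apply: ler_wiXn2l => //; lra.
have etaE n : 8 * eta n * (d + 1) = 4^-1 ^+ n.
  rewrite /eta; field; lra.
have eta1 n : eta n <= 1.
  have : (4^-1 : R) ^+ n <= 1 by rewrite exprn_ile1//; lra.
  rewrite -etaE; have := eta0 n; nra.
have [||l lw] := @cauchy_hnorm_cvg _ w (fun n => 2^-1 ^+ n).
- by [].
- move=> n m nm.
  rewrite -(@ler_pXn2r _ 2)// ?nnegrE ?hnorm_ge0 ?exprn_ge0 ?invr_ge0//.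
  rewrite -exprM mulnC exprM (_ : 2^-1 ^+ 2 = 4^-1); last by rewrite exprVn -natrX.
  rewrite -etaE.
  have := parallelogram (y - w n) (y - w m).
  have -> : y - w n - (y - w m) = w m - w n by rewrite opprB addrC addrA subrK.
  have -> : y - w n + (y - w m) = 2 *: (y - 2^-1 *: (w n + w m)).
    rewrite scalerBr scalerA divff ?pnatr_eq0// scale1r scaler_nat mulr2n opprD.
    by rewrite addrACA.
  rewrite hnormZ.
  have -> : normc (2 : R[i]) = 2.
    by rewrite -(rmorph_nat (real_complex R)) normc_real ger0_norm.
  have := dmin _ (subspaceZ 2^-1 sW (subspaceD sW (Hw n).1 (Hw m).1)).
  have := (Hw n).2; have := (Hw m).2; have := eta_le _ _ nm.
  move: (hnorm_ge0 (y - w n)) (hnorm_ge0 (y - w m)) (hnorm_ge0 (w m - w n)).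
  have := eta1 n; have := eta0 n; have := eta0 m.
  move: (hnorm (y - w n)) (hnorm (y - w m)) (hnorm (w m - w n))
    (hnorm (y - 2^-1 *: _)) (eta n) (eta m).
  move=> a b c f en em em0 en0 en1 a0 b0 c0 emn bd ad df eq.
  have a2 : a ^+ 2 <= (d + en) ^+ 2 by rewrite ler_pXn2r// ?nnegrE; lra.
  have b2 : b ^+ 2 <= (d + en) ^+ 2 by rewrite ler_pXn2r// ?nnegrE; lra.
  have f2 : d ^+ 2 <= f ^+ 2 by rewrite ler_pXn2r// ?nnegrE; lra.
  nra.
have Wl : W l.
  apply: cW => e e0; have [n ne] := expr2V_lt e0.
  by exists (w n); [exact: (Hw n).1|exact: le_lt_trans (lw n) ne].
exists l => //; apply: nearest_point_orth => // u Wu.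
(* What remains is [hnorm (y - l) <= d]; the detour through [w n] costs at most
   [eta n + 2^-1 ^+ n]. *)
rewrite -addrA -opprD (le_trans _ (dmin _ (subspaceD sW Wl Wu)))//.
apply: (@le_of_le_expr2V _ _ _ 2) => n.
rewrite -(subrK (w n) y) -addrA (le_trans (ler_hnormD _ _))//.
have /ltW := (Hw n).2; have := lw n; rewrite (hnorm_distC l).
have : eta n <= 2^-1 ^+ n.
  apply: (@le_trans _ _ (4^-1 ^+ n)).
    by rewrite -etaE; have := eta0 n; nra.
  by rewrite lerXn2r// ?nnegrE ?lef_pV2 ?posrE//; lra.
lra.
Qed.

(** Take [v] orthogonal to the closed kernel of [f] with [f v != 0]. Since [x - (f x / f v) *: v]
    lies in the kernel, pairing it with [v] expresses [f x] through <x, v>. The scalar in front of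
    [v] is conjugated because the second argument is conjugate-linear. *)
Lemma riesz (E : hilbertType R) (f : E -> R[i]) (M : R) :
  (forall a x y, f (a *: x + y) = a * f x + f y) ->
  (forall x, normc (f x) <= M * hnorm x) ->
  exists u, forall x, f x = '[x, u].
Proof.
move=> fL fM.
have f0 : f 0 = 0.
  have /esym/eqP := fL 1 0 0; rewrite scaler0 addr0 mul1r.
  by rewrite -subr_eq0 addrK => /eqP.
have fZ a x : f (a *: x) = a * f x by rewrite -[_ *: _]addr0 fL f0 addr0.
have fD x y : f (x + y) = f x + f y by rewrite -[x in LHS]scale1r fL mul1r.
have fB x y : f (x - y) = f x - f y by rewrite fD -scaleN1r fZ mulN1r.
have [fz|] := pselect (forall x, f x = 0).
  by exists 0 => x; rewrite hdot0r.
move=> /existsNP[e fe].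
pose W := [set x | f x = 0].
have sW : is_subspace W.
  by split => // a x y; rewrite /W /= fL => -> ->; rewrite mulr0 addr0.
have cW : hclosed W.
  move=> x xW; apply: eq0_normc; apply/eqP; rewrite eq_le normc_ge0 andbT.
  apply: (@le_of_le_expr2V _ _ _ `|M|) => n; rewrite add0r.
  have [|w Ww /ltW xw] := xW (2^-1 ^+ n); first by rewrite exprn_gt0// invr_gt0.
  have -> : f x = f (x - w) by rewrite fB Ww subr0.
  apply: (le_trans (fM _)); apply: (@le_trans _ _ (`|M| * hnorm (x - w))).
    by rewrite ler_wpM2r ?hnorm_ge0 ?ler_norm.
  by rewrite ler_wpM2l.
have [w Ww vW] := projection e sW cW.
set v := e - w in vW.
have fv : f v = f e by rewrite fB Ww subr0.
have fv0 : f v != 0 by rewrite fv; exact/eqP.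
have vv0 : '[v, v] != 0.
  by apply: contra_neq fv0 => /hdotxx_eq0 ->.
exists (Num.conj (f v / '[v, v]) *: v) => x.
have Wx : W (x - (f x / f v) *: v) by rewrite /W/= fB fZ divfK// subrr.
have /eqP := hdot_eq0C (vW _ Wx).
rewrite hdotBl hdotZl subr_eq0 hdotZr conjCK => /eqP ->.
by field; rewrite fv0 vv0.
Qed.

End Completeness.

(** * Bounded operators *)

Section BoundedOperators.
Context {R : realType}.

Definition bounded_by (E F : hilbertType R) (M : R) (B : E -> F) :=
  0 <= M /\ forall x, hnorm (B x) <= M * hnorm x.

Lemma bounded_operatorP (E F : hilbertType R) (B : E -> F) :
  bounded_operator B <-> linear B /\ exists M, bounded_by M B.
Proof.
split=> -[lB BB]; split => //.
  pose f : {linear E -> F} := HB.pack B (GRing.isLinear.Build _ _ _ _ B lB).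
  have := (@linear_bounded_continuous _ _ _ f).2 BB.
  move=> /linear_boundedP/pinfty_ex_gt0[M M0 HM].
  have Mr : M = (complex.Re M)%:C by rewrite RRe_real// gtr0_real.
  exists (complex.Re M); split.
    by rewrite -ler0c -Mr ltW.
  by move=> x; rewrite -lecR rmorphM/= -Mr -!normE; exact: HM.
pose f : {linear E -> F} := HB.pack B (GRing.isLinear.Build _ _ _ _ B lB).
have [M [M0 HM]] := BB.
apply: (@bounded_linear_continuous _ _ _ f); apply/linear_boundedP.
exists M%:C; split; first by apply/complex_realP; exists M.
move=> N /ltW MN x; apply: (@le_trans _ _ (M%:C * `|x|)).
  by rewrite !normE -rmorphM/= lecR.
by rewrite ler_wpM2r.
Qed.

Lemma linear_comp (E F G : hilbertType R) (B : E -> F) (C : F -> G) :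
  linear B -> linear C -> linear (C \o B).
Proof. by move=> lB lC a x y /=; rewrite lB lC. Qed.

Lemma linear_lincomb (E F : hilbertType R) (a b : R[i]) (B C : E -> F) :
  linear B -> linear C -> linear (fun x => a *: B x + b *: C x).
Proof.
move=> lB lC c x y /=; rewrite lB lC !scalerDr !scalerA addrACA.
by rewrite (mulrC a) (mulrC b).
Qed.

Lemma bounded_by_comp (E F G : hilbertType R) M N (B : E -> F) (C : F -> G) :
  bounded_by M B -> bounded_by N C -> bounded_by (N * M) (C \o B).
Proof.
move=> [M0 BM] [N0 CN]; split => [|x /=]; first exact: mulr_ge0.
by rewrite (le_trans (CN _))// -mulrA ler_wpM2l.
Qed.

Lemma bounded_by_lincomb (E F : hilbertType R) M N (a b : R[i]) (B C : E -> F) :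
  bounded_by M B -> bounded_by N C ->
  bounded_by (normc a * M + normc b * N) (fun x => a *: B x + b *: C x).
Proof.
move=> [M0 BM] [N0 CN]; split => [|x /=].
  by rewrite addr_ge0// mulr_ge0// normc_ge0.
rewrite (le_trans (ler_hnormD _ _))// !hnormZ mulrDl -!mulrA.
by rewrite lerD// ler_wpM2l ?normc_ge0.
Qed.

Lemma linear_morphE (E F : hilbertType R) (B : E -> F) : linear B ->
  [/\ B 0 = 0, forall a x, B (a *: x) = a *: B x,
     forall x y, B (x + y) = B x + B y & forall x y, B (x - y) = B x - B y].
Proof.
move=> lB; pose f : {linear E -> F} := HB.pack B (GRing.isLinear.Build _ _ _ _ B lB).
split.
- exact: (linear0 f).
- by move=> a x; exact: (linearZ_LR f).
- by move=> x y; exact: (raddfD f).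
- by move=> x y; exact: (raddfB f).
Qed.

(** Riesz applied to the functional <B x, y> of [x] shows that the set in [badjoint] is inhabited,
    so [xget] does not fall back to 0. *)
Lemma badjointP (E F : hilbertType R) M (B : E -> F) :
  linear B -> bounded_by M B -> forall x y, '[B x, y] = '[x, badjoint B y].
Proof.
move=> lB [M0 BM] x y; apply: (@xgetPex _ 0 [set u | forall x, '[B x, y] = '[x, u]]).
apply: (@riesz _ _ _ (M * hnorm y)) => [a u v|u].
  by rewrite lB hdotDl hdotZl.
by rewrite (le_trans (cauchy_schwarz _ _))// mulrAC ler_wpM2r ?hnorm_ge0.
Qed.

Lemma badjoint_linear (E F : hilbertType R) M (B : E -> F) :
  linear B -> bounded_by M B -> linear (badjoint B).
Proof.
move=> lB BM a x y; apply: hdot_extr => z.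
by rewrite hdotDr hdotZr -!(badjointP lB BM) hdotDr hdotZr.
Qed.

(** For u the image of y under the adjoint, |u|^2 = <B u, y> <= M |u| |y|; divide by |u|. *)
Lemma badjoint_bounded (E F : hilbertType R) M (B : E -> F) :
  linear B -> bounded_by M B -> bounded_by M (badjoint B).
Proof.
move=> lB BM; have [M0 HM] := BM; split => // y; set u := badjoint B y.
have [u0|u0] := eqVneq (hnorm u) 0; first by rewrite u0 mulr_ge0 ?hnorm_ge0.
rewrite -(ler_pM2l (_ : 0 < hnorm u)); last by rewrite lt_def u0 hnorm_ge0.
have -> : hnorm u * hnorm u = normc '[B u, y].
  rewrite (badjointP lB BM) hdotxx normc_real.
  by rewrite ger0_norm ?sqr_ge0.
rewrite (le_trans (cauchy_schwarz _ _))// mulrA ler_wpM2r ?hnorm_ge0//.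
by rewrite mulrC.
Qed.

(* Gliding hump: moving by [4^-n] in the direction of the n-th vector of a
   fast growing sequence makes the n-th pairing large, and the later moves
   are too small to spoil it. *)
Lemma uniform_boundedness (F : hilbertType R) (Z : set F) :
  (forall y, exists M : R, forall z, Z z -> normc '[y, z] <= M) ->
  exists M : R, forall z, Z z -> hnorm z <= M.
Proof.
move=> Zpw; apply: contrapT => /forallNP nM.
have /choice[z Hz] n : exists z, Z z /\ 16 ^+ n < hnorm z.
  have /existsNP[z /not_implyP[Zz /negP]] := nM (16 ^+ n).
  by rewrite -ltNge; exists z.
have z0 n : 0 < hnorm (z n) by apply: lt_trans (Hz n).2; rewrite exprn_gt0.
pose q n : R := 4^-1 ^+ n.
have q0 n : 0 < q n by rewrite exprn_gt0// invr_gt0.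
have qS n : q n.+1 = q n / 4 by rewrite /q exprSr.
(* The pairings of [x + u] and [x - u] with [z n] differ by twice <u, z n>, so one of the two is at
   least as large as |<u, z n>|. *)
have step (p : nat * F) : exists x, hnorm (x - p.2) <= q p.1.+1 /\
    q p.1.+1 * hnorm (z p.1) <= normc '[x, z p.1].
  case: p => n x /=.
  pose u := (q n.+1 / hnorm (z n))%:C *: z n.
  have uq : hnorm u = q n.+1.
    rewrite hnormZ normc_real ger0_norm; last first.
      by rewrite divr_ge0// ltW.
    by rewrite divfK// gt_eqF.
  have uz : normc '[u, z n] = q n.+1 * hnorm (z n).
    rewrite hdotZl hdotxx -rmorphM normc_real ger0_norm.
      by rewrite expr2 mulrA divfK// gt_eqF.
    by rewrite mulr_ge0 ?divr_ge0 ?sqr_ge0 ?ltW.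
  have [|/ltW xu] := leP (q n.+1 * hnorm (z n)) (normc '[x + u, z n]).
    by exists (x + u); rewrite addrC addKr uq.
  exists (x - u); rewrite addrC addKr hnorm_opp uq; split => //.
  have := le_normcD '[x + u, z n] (- '[x - u, z n]).
  have -> : '[x + u, z n] - '[x - u, z n] = 2%:C * '[u, z n].
    by rewrite !hdotDl hdotNl rmorph_nat; ring.
  rewrite normcM normcN uz normc_real ger0_norm; last lra.
  by move: xu; lra.
have [next Hnext] := choice step.
pose x := fix x n := if n is m.+1 then next (m, x m) else 0.
(* The right-hand side is the geometric sum of the step lengths [q n.+1], ..., [q (n + k)]. *)
have xd n k : hnorm (x (n + k)%N - x n) <= (q n - q (n + k)%N) / 3.
  elim: k => [|k IH]; first by rewrite addn0 !subrr hnorm0 mul0r.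
  rewrite addnS -(subrK (x (n + k)%N) (x (n + k).+1)) -addrA.
  rewrite (le_trans (ler_hnormD _ _))//.
  have := (Hnext ((n + k)%N, x (n + k)%N)).1; rewrite /= qS; lra.
have xd' n m : (n <= m)%N -> hnorm (x m - x n) <= q n / 3.
  by move=> nm; have := xd n (m - n)%N; rewrite subnKC//; have := q0 m; lra.
have [|l xl] := cauchy_hnorm_cvg _ xd'.
  move=> n; apply: (@le_trans _ _ (q n)); first by have := q0 n; lra.
  by apply: lerXn2r; rewrite ?nnegrE ?lef_pV2 ?posrE//; lra.
have [M HM] := Zpw l.
(* The moves after [x n.+1] total at most a third of [q n.+1], so |<l, z n>| is at least 2/3 of
   [q n.+1 * hnorm (z n)], that is [q n * hnorm (z n) / 6]. This exceeds 4^n / 6, as |z n| >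
   16^n. *)
have [n nM'] : exists n : nat, 6 * M < 4 ^+ n.
  exists (Num.truncn (6 * M)).+1; rewrite (lt_trans (truncnS_gt _))//.
  by rewrite -natrX ltr_nat; exact: ltn_expl.
have := HM _ (Hz n).1; have := (Hnext (n, x n)).2 => /= h1 h2.
have := le_normcD '[l, z n] '[x n.+1 - l, z n].
rewrite -hdotDl addrC subrK => h3.
have h4 : normc '[x n.+1 - l, z n] <= q n.+1 / 3 * hnorm (z n).
  rewrite (le_trans (cauchy_schwarz _ _))// ler_wpM2r ?hnorm_ge0//.
  by rewrite hnorm_distC.
have h5 : q n * 16 ^+ n = 4 ^+ n.
  by rewrite -exprMn; congr (_ ^+ _); field.
have : q n * 16 ^+ n < q n * hnorm (z n) by rewrite ltr_pM2l// (Hz n).2.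
rewrite h5; rewrite /= qS in h1 h3 h4 *; move: h1 h2 h3 h4 nM'.
by move: (q n) (hnorm _) (4 ^+ n) (normc _) (normc _) (normc _) => *; nra.
Qed.

(** * Bounded surjections and the closed range of their adjoints *)

Section ClosedRange.
Context {E F : hilbertType R} (B : E -> F) (M : R).
Hypotheses (lB : linear B) (BM : bounded_by M B)
  (B_surj : forall y, exists x, B x = y).

(** Uniform boundedness applies to the vectors whose image under the adjoint has norm at most 1:
    against y = B x their pairing is at most |x|. Scaling turns the resulting bound into the
    estimate. *)
Lemma badjoint_below : exists2 C : R, 0 <= C &
  forall y, hnorm y <= C * hnorm (badjoint B y).
Proof.
have lA := badjoint_linear lB BM.
have [_ AZ _ _] := linear_morphE lA.
have [y|C HC] := @uniform_boundedness _ [set z | hnorm (badjoint B z) <= 1].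
  have [x <-] := B_surj y; exists (hnorm x) => z /= z1.
  rewrite (badjointP lB BM) (le_trans (cauchy_schwarz _ _))//.
  by rewrite ler_piMr// hnorm_ge0.
have C0 : 0 <= C.
  rewrite -(@hnorm0 _ F); apply: HC => /=.
  by have [-> _ _ _] := linear_morphE lA; rewrite hnorm0.
exists C => // y; have [u0|u0] := eqVneq (hnorm (badjoint B y)) 0.
  suff -> : y = 0 by rewrite hnorm0 mulr_ge0 ?hnorm_ge0.
  apply: hdotxx_eq0; have [x {1}<-] := B_surj y.
  by rewrite (badjointP lB BM) (hnorm_eq0 u0) hdot0r.
have u1 : 0 < hnorm (badjoint B y) by rewrite lt_def u0 hnorm_ge0.
have := HC ((hnorm (badjoint B y))^-1%:C *: y).
rewrite /= AZ !hnormZ normc_real ger0_norm ?invr_ge0 ?(ltW u1)//.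
by rewrite mulVf// lexx => /(_ erefl); rewrite mulrC ler_pdivrMr.
Qed.

(** By [badjoint_below] the range of the adjoint is closed, so [v] projects onto it. The residual u
    is orthogonal to this range, whence B u = 0 and <u, v> = 0; both together give <u, u> = 0. *)
Lemma ker_orth_badjoint (v : E) : (forall x, B x = 0 -> '[x, v] = 0) ->
  exists y, v = badjoint B y.
Proof.
move=> vB; have lA := badjoint_linear lB BM.
have [A0 AZ AD AB] := linear_morphE lA.
have [C C0 HC] := badjoint_below.
pose W := [set badjoint B y | y in [set: F]].
have sW : is_subspace W.
  split=> [|a _ _ [y _ <-] [z _ <-]]; first by exists 0.
  by exists (a *: y + z) => //; rewrite lA.
have cW : hclosed W.
  move=> x xW.
  have half n : 0 < 2^-1 ^+ n :> R by rewrite exprn_gt0// invr_gt0.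
  have C1 : 0 < 2 * (C + 1) by lra.
  (* Two such approximations with indices at least n have images at distance at most 2^-n / (C + 1),
     which [badjoint_below] turns into [hnorm (y m - y n) <= 2^-1 ^+ n]; [C + 1] avoids dividing by
     zero. *)
  have /choice[y Hy] n : exists y,
      hnorm (x - badjoint B y) < 2^-1 ^+ n / (2 * (C + 1)).
    have [|_ [y _ <-] lt] := xW (2^-1 ^+ n / (2 * (C + 1))); last by exists y.
    by rewrite divr_gt0.
  have e2 n : 2^-1 ^+ n / (2 * (C + 1)) * (C + 1) = 2^-1 ^+ n / 2 :> R.
    by field; rewrite gt_eqF//; lra.
  have [||l yl] := @cauchy_hnorm_cvg _ _ y (fun n => 2^-1 ^+ n).
  - by [].
  - move=> n m nm; rewrite (le_trans (HC _))// AB.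
    rewrite -(subrK x (badjoint B (y m))) -addrA.
    have := ler_hnormD (badjoint B (y m) - x) (x - badjoint B (y n)).
    have /ltW := Hy n; have /ltW := Hy m; rewrite (hnorm_distC x (badjoint B (y m))).
    have : 2^-1 ^+ m <= 2^-1 ^+ n :> R.
      by apply: ler_wiXn2l => //; lra.
    have := e2 m; have := e2 n.
    move: (hnorm_ge0 (badjoint B (y m) - x)) (hnorm_ge0 (x - badjoint B (y n))).
    move: (hnorm _) (hnorm _) (hnorm _) (2^-1 ^+ n / (2 * (C + 1)))
     (2^-1 ^+ m / (2 * (C + 1))) => a b c p r a0 b0 pn rm mn ar bp cab.
    have : C * c <= C * (r + p) by rewrite ler_wpM2l//; lra.
    have := half n; have := half m.
    have := mulr_ge0 a0 C0; nra.
  exists l => //; apply/eqP; rewrite -subr_eq0; apply/eqP/hnorm_eq0.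
  apply/eqP; rewrite eq_le hnorm_ge0 andbT.
  have [M0 HM] := badjoint_bounded lB BM.
  apply: (@le_of_le_expr2V _ _ _ (M + 1)) => n; rewrite add0r.
  rewrite -(subrK (badjoint B (y n)) (badjoint B l)) -addrA -AB.
  rewrite (le_trans (ler_hnormD _ _))// mulrDl mul1r lerD//.
    by rewrite (le_trans (HM _))// ler_wpM2l.
  rewrite hnorm_distC; apply/ltW/(lt_le_trans (Hy n)).
  rewrite ler_pdivrMr// ler_peMr ?ltW//; lra.
have [_ [y _ <-] vW] := projection v sW cW.
exists y; apply/eqP; rewrite -subr_eq0; apply/eqP; apply: hdotxx_eq0.
rewrite {2}[badjoint B y]lock hdotBr -lock.
set u := v - badjoint B y in vW *.
rewrite (vW (badjoint B y)); last by exists y.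
rewrite subr0; apply: vB; apply: hdot_extl => z; rewrite hdot0l.
by rewrite (badjointP lB BM) vW//; exists z.
Qed.

End ClosedRange.
End BoundedOperators.

(** * Adjoints and resolvents *)

Section AdjointTheory.
Context {R : realType} {H : hilbertType R}.
Implicit Types (T : pop H H) (x y u v : H) (z : R[i]).

Lemma normc_le0 z : (forall e : R, 0 < e -> normc z <= e) -> z = 0.
Proof.
move=> ze; apply: eq0_normc; apply/eqP; rewrite eq_le normc_ge0 andbT.
by apply/ler_addgt0Pr => e e0; rewrite add0r; exact: ze.
Qed.

(** For [x] in [D] close to [u], <u, u> = <u - x, u> is small. *)
Lemma dense_orth (D : set H) u :
  dense D -> (forall x, D x -> '[x, u] = 0) -> u = 0.
Proof.
move=> dD Du; apply: hdotxx_eq0; apply: normc_le0 => e e0.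
have d0 : 0 < e / (hnorm u + 1) by rewrite divr_gt0// ltr_wpDl// hnorm_ge0.
have [x [ux Dx]] : ball u (e / (hnorm u + 1))%:C `&` D !=set0.
  apply: dD; first by exists u; apply: ballxx; rewrite (ltcR 0).
  exact: ball_open.
move: ux; rewrite -ball_normE /= normE ltcR => /ltW ux.
have -> : '[u, u] = '[u - x, u] by rewrite hdotBl (Du x Dx) subr0.
rewrite (le_trans (cauchy_schwarz _ _))//.
rewrite (@le_trans _ _ (e / (hnorm u + 1) * hnorm u)) ?ler_wpM2r ?hnorm_ge0//.
rewrite mulrAC ler_pdivrMr ?ltr_wpDl ?hnorm_ge0// ler_wpM2l ?(ltW e0)//.
by rewrite lerDl.
Qed.

Lemma adjoint_value_uniq T y u v : densely_defined T ->
  is_adjoint_value T y u -> is_adjoint_value T y v -> u = v.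
Proof.
move=> dT Tu Tv; apply/eqP; rewrite -subr_eq0; apply/eqP.
by apply: (dense_orth dT) => x Dx; rewrite hdotBr -Tu// -Tv// subrr.
Qed.

Lemma adjointP T y : dom (adjoint T) y -> is_adjoint_value T y (adjoint T y).
Proof.
move=> [u Tu]; apply: (@xgetPex _ 0 [set u | is_adjoint_value T y u]).
by exists u.
Qed.

Lemma adjoint_eq T y u : densely_defined T -> is_adjoint_value T y u ->
  adjoint T y = u.
Proof.
move=> dT Tu; apply: (adjoint_value_uniq dT _ Tu).
by apply: adjointP; exists u.
Qed.

Lemma adjoint_linear_on T : densely_defined T ->
  linear_on (dom (adjoint T)) (adjoint T).
Proof.
move=> dT.
have lin a x y : dom (adjoint T) x -> dom (adjoint T) y ->
    is_adjoint_value T (a *: x + y) (a *: adjoint T x + adjoint T y).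
  move=> Dx Dy w Dw.
  by rewrite !hdotDr !hdotZr (adjointP Dx)// (adjointP Dy).
split.
- by exists 0 => x Dx; rewrite !hdot0r.
- by move=> a x y Dx Dy; exists (a *: adjoint T x + adjoint T y); exact: lin.
- by move=> a x y Dx Dy; apply: adjoint_eq => //; exact: lin.
Qed.

Lemma resolventP T z : resolvent_set T z ->
  [/\ bounded_operator (resolvent T z),
      forall y, dom T (resolvent T z y) /\
        - T (resolvent T z y) + z *: resolvent T z y = y
    & forall x, dom T x -> resolvent T z (- T x + z *: x) = x].
Proof.
move=> [B [bB BR BL]].
suff -> : resolvent T z = B by split.
apply/funext => y; rewrite /resolvent.
have : [set x | dom T x /\ - T x + z *: x = y] (B y) by exact: BR.
by move=> /(@xgetI _ 0)[Dx] /(congr1 B); rewrite BL.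
Qed.

Lemma op_eq_resolvent_set T T' : op_eq T T' -> resolvent_set T = resolvent_set T'.
Proof.
suff sub T1 T2 : op_eq T1 T2 -> resolvent_set T1 `<=` resolvent_set T2.
  move=> [DT TT]; apply/seteqP; split; apply: sub; split => // x.
  by rewrite -DT => Dx; rewrite TT.
move=> [DT TT] z [B [bB BR BL]]; exists B; split => //.
  by move=> y; have [Dy e] := BR y; rewrite -DT -TT.
by move=> x; rewrite -DT => Dx; rewrite -TT// BL.
Qed.

Lemma linear_onE (F : lmodType R[i]) (D : set H) (f : H -> F) : linear_on D f ->
  [/\ is_subspace D,
      forall a x, D x -> f (a *: x) = a *: f x,
      forall x y, D x -> D y -> f (x + y) = f x + f y
    & forall x y, D x -> D y -> f (x - y) = f x - f y].
Proof.
move=> [D0 DD fL].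
have f0 : f 0 = 0.
  apply/eqP; rewrite -(subrr (f 0)) -subr_eq0 opprB addrA.
  by have := fL 1 0 0 D0 D0; rewrite !scale1r addr0 => <-; rewrite subrr.
have sD : is_subspace D by [].
have fZ a x : D x -> f (a *: x) = a *: f x.
  by move=> Dx; rewrite -[a *: x]addr0 fL// f0 addr0.
have fD x y : D x -> D y -> f (x + y) = f x + f y.
  by move=> Dx Dy; rewrite -{1}[x]scale1r fL// scale1r.
split => // x y Dx Dy.
by rewrite fD//; [rewrite -(scaleN1r y) fZ// scaleN1r|exact: subspaceN].
Qed.

End AdjointTheory.

(** * Resolvent sets of self-adjoint operators *)

Section SelfAdjoint.
Context {R : realType} {H : hilbertType R} {A : pop H H}.
Hypothesis sA : self_adjoint A.
Implicit Types (x y u v : H) (z : R[i]).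

Lemma sa_adjoint_value x : dom A x -> is_adjoint_value A x (A x).
Proof.
have [_ _ [DA AA]] := sA.
by move=> Dx; rewrite AA//; apply: adjointP; rewrite -DA.
Qed.

Lemma sa_symmetric : symmetric_op A.
Proof. by move=> x y Dx Dy; exact: sa_adjoint_value. Qed.

(** The tool for proving membership in [dom A]: a weak solution is a genuine one. *)
Lemma sa_maximal x u : is_adjoint_value A x u -> dom A x /\ A x = u.
Proof.
have [_ dA [DA AA]] := sA => xu.
have Dx : dom A x by rewrite DA; exists u.
by split => //; rewrite AA//; exact: adjoint_eq.
Qed.

Lemma sa_linearE : [/\ is_subspace (dom A),
      forall a x, dom A x -> A (a *: x) = a *: A x,
      forall x y, dom A x -> dom A y -> A (x + y) = A x + A y
    & forall x y, dom A x -> dom A y -> A (x - y) = A x - A y].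
Proof. by have [lA _ _] := sA; exact: linear_onE. Qed.

Lemma sa_shift z x y : dom A x -> dom A y ->
  '[- A x + Num.conj z *: x, y] = '[x, - A y + z *: y].
Proof.
move=> Dx Dy; rewrite hdotDl hdotNl hdotZl hdotDr hdotNr hdotZr.
by rewrite sa_symmetric.
Qed.

(** The adjoint of the resolvent at [z] inverts the shift at the conjugate point; [sa_maximal]
    places its values in [dom A]. *)
Lemma resolvent_set_conj z : resolvent_set A z -> resolvent_set A (Num.conj z).
Proof.
move=> [B [/bounded_operatorP[lB [M BM]] BR BL]].
have adj := badjointP lB BM.
have inv y : dom A (badjoint B y) /\
    - A (badjoint B y) + Num.conj z *: badjoint B y = y.
  have [|Dx Ax] := @sa_maximal (badjoint B y) (Num.conj z *: badjoint B y - y).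
    move=> x Dx.
    have e : '[x, y] = - '[A x, badjoint B y] + z * '[x, badjoint B y].
      by rewrite -{1}(BL x Dx) adj hdotDl hdotNl hdotZl.
    by rewrite hdotBr hdotZr conjCK e; ring.
  by split => //; rewrite Ax opprB subrK.
exists (badjoint B); split => //.
  apply/bounded_operatorP; split; first exact: badjoint_linear lB BM.
  by exists M; exact: badjoint_bounded.
move=> x Dx; apply: hdot_extr => y.
have [Dy yE] := BR y.
by rewrite -adj -sa_shift// conjCK yE.
Qed.

(** * Invertibility of the shift at i and -i *)

Section ImaginaryShift.
Variable z : R[i].
Hypotheses (zJ : Num.conj z = - z) (z1 : normc z = 1).

(** The cross terms cancel, since [A] is symmetric and [z] is purely imaginary. *)
Lemma shift_pythagoras x : dom A x ->
  hnorm (- A x + z *: x) ^+ 2 = hnorm (A x) ^+ 2 + hnorm x ^+ 2.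
Proof.
move=> Dx; apply: complexI; rewrite rmorphD/= -!hdotxx.
have zz : z * z = -1.
  have := normCK z; rewrite (_ : `|z| = 1) ?zJ; last by rewrite /Num.norm/= z1.
  by rewrite expr1n mulrN => ->; rewrite opprK.
rewrite hdotDl !hdotDr !hdotNl !hdotNr !hdotZl !hdotZr zJ (sa_symmetric Dx Dx).
have -> : z * (- z * '[x, x]) = - (z * z) * '[x, x] by ring.
by rewrite zz; ring.
Qed.

Lemma shift_le x : dom A x -> hnorm x <= hnorm (- A x + z *: x).
Proof.
move=> Dx; rewrite -(@ler_pXn2r _ 2)// ?nnegrE ?hnorm_ge0//.
by rewrite shift_pythagoras// lerDr sqr_ge0.
Qed.

(** The range is closed because [shift_le] bounds the shift from below. A vector v orthogonal to it
    satisfies A v = - z v by maximality; then v is orthogonal to its own shift 2 z v, so v = 0. *)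
Lemma shift_surj y : exists x, dom A x /\ - A x + z *: x = y.
Proof.
have [sD AZ AD AB] := sa_linearE.
have shiftB u v : dom A u -> dom A v ->
    - A u + z *: u - (- A v + z *: v) = - A (u - v) + z *: (u - v).
  by move=> Du Dv; rewrite AB// scalerBr !opprD addrACA !opprK.
pose W := [set - A x + z *: x | x in dom A].
have sW : is_subspace W.
  split=> [|a _ _ [u Du <-] [v Dv <-]].
    have D0 := sD.1; exists 0 => //.
    by have := AZ 0 0 D0; rewrite !scale0r => ->; rewrite oppr0 scaler0 addr0.
  exists (a *: u + v); first exact: sD.2.
  have Dau := subspaceZ a sD Du.
  rewrite AD// AZ// !scalerDr scalerN opprD addrACA.
  by rewrite !scalerA mulrC.
have cW : hclosed W.
  move=> w wW.
  have half n : 0 < 2^-1 ^+ n :> R by rewrite exprn_gt0// invr_gt0.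
  have /choice[x Hx] n : exists x, dom A x /\
      hnorm (w - (- A x + z *: x)) < 2^-1 ^+ n / 2.
    have [|_ [x Dx <-] lt] := wW (2^-1 ^+ n / 2); first by rewrite divr_gt0.
    by exists x.
  have [||l xl] := @cauchy_hnorm_cvg _ _ x (fun n => 2^-1 ^+ n).
  - by [].
  - move=> n m nm; have [Dn /ltW Hn] := Hx n; have [Dm /ltW Hm] := Hx m.
    rewrite (le_trans (shift_le (subspaceB sD Dm Dn)))// -shiftB//.
    rewrite -(subrK w (- A (x m) + _)) -addrA.
    rewrite (le_trans (ler_hnormD _ _))// hnorm_distC.
    have : 2^-1 ^+ m <= 2^-1 ^+ n :> R by apply: ler_wiXn2l => //; lra.
    lra.
  (* The limit [l] is a weak solution: each [x n] satisfies the tested equation up to errors of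
     order 2^-n, whose coefficients [K] collects. *)
  have [|Dl Al] := @sa_maximal l (z *: l - w); last first.
    by exists l => //; rewrite Al opprB subrK.
  move=> v Dv; apply/eqP; rewrite -subr_eq0; apply/eqP/normc_le0 => e e0.
  pose K := hnorm (A v) + hnorm v * 2 + 1.
  have K0 : 0 < K by rewrite /K; have := hnorm_ge0 (A v); have := hnorm_ge0 v; lra.
  have [n ne] := @expr2V_lt _ (e / K) (divr_gt0 e0 K0).
  have [Dn /ltW Hn] := Hx n.
  have -> : '[A v, l] - '[v, z *: l - w] =
      '[A v, l - x n] + '[v, (w - (- A (x n) + z *: x n)) - z *: (l - x n)].
    by rewrite !(hdotBr, hdotDr, hdotNr, hdotZr) (sa_symmetric Dv Dn); ring.
  rewrite (le_trans (le_normcD _ _))//.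
  have h1 := cauchy_schwarz (A v) (l - x n).
  have h2 := cauchy_schwarz v ((w - (- A (x n) + z *: x n)) - z *: (l - x n)).
  have h3 := ler_hnormD (w - (- A (x n) + z *: x n)) (- (z *: (l - x n))).
  rewrite hnorm_opp hnormZ z1 mul1r in h3.
  have h4 := xl n.
  have h5 : hnorm (A v) * hnorm (l - x n) <= hnorm (A v) * 2^-1 ^+ n.
    by rewrite ler_wpM2l ?hnorm_ge0.
  have h6 : hnorm v * hnorm (w - (- A (x n) + z *: x n) - z *: (l - x n)) <=
      hnorm v * (2 * 2^-1 ^+ n).
    by rewrite ler_wpM2l ?hnorm_ge0//; have := half n; lra.
  have h7 : 2^-1 ^+ n * K <= e by rewrite -ler_pdivlMr// ltW.
  move: h7; rewrite /K; have := half n; lra.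
have [_ [x Dx <-] wW] := projection y sW cW.
exists x; split => //; apply/eqP; rewrite eq_sym -subr_eq0; apply/eqP.
set v := y - _ in wW *.
have [|Dv Av] := @sa_maximal v (- z *: v).
  move=> u Du; have := hdot_eq0C (wW _ (imageP _ Du)).
  rewrite hdotDl hdotNl hdotZl hdotZr rmorphN/= zJ opprK.
  by move=> /eqP; rewrite addrC subr_eq0 => /eqP.
have := wW _ (imageP _ Dv); rewrite Av scaleNr opprK -mulr2n -scaler_nat.
rewrite !hdotZr => /eqP; rewrite !mulf_eq0 !conjC_eq0 pnatr_eq0/=.
have -> : z == 0 = false by apply/eqP => z0; move: z1; rewrite z0 normc0; lra.
by move=> /eqP/hdotxx_eq0.
Qed.

Lemma imaginary_resolvent : resolvent_set A z.
Proof.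
have [sD AZ AD AB] := sa_linearE.
have [B HB] := choice shift_surj.
have uniq u v : dom A u -> dom A v ->
    - A u + z *: u = - A v + z *: v -> u = v.
  move=> Du Dv uv; apply/eqP; rewrite -subr_eq0; apply/eqP/hnorm_eq0/eqP.
  rewrite eq_le hnorm_ge0 andbT (le_trans (shift_le (subspaceB sD Du Dv)))//.
  have -> : - A (u - v) + z *: (u - v) = - A u + z *: u - (- A v + z *: v).
    by rewrite AB// scalerBr !opprD addrACA.
  by rewrite uv subrr hnorm0.
exists B; split => //.
  apply/bounded_operatorP; split.
    move=> a u v; have [Du uE] := HB u; have [Dv vE] := HB v.
    have [Duv uvE] := HB (a *: u + v).
    apply: uniq => //; first exact: sD.2.
    have Dau := subspaceZ a sD Du.
    rewrite uvE AD// AZ// !scalerDr.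
    rewrite -{1}uE -{1}vE scalerDr scalerN opprD [RHS]addrACA.
    by rewrite !scalerA mulrC.
  exists 1; split => // x; have [Dx xE] := HB x.
  by rewrite mul1r -{2}xE shift_le.
move=> x Dx; apply: uniq => //; first exact: (HB _).1.
exact: (HB _).2.
Qed.

End ImaginaryShift.

Lemma imaginary_resolvent_i : resolvent_set A 'i /\ resolvent_set A (- 'i).
Proof.
have i1 : normc ('i : R[i]) = 1.
  by apply: complexI; exact: normCi.
split; apply: imaginary_resolvent => //.
- by rewrite conjCi.
- by rewrite rmorphN/= conjCi.
- by rewrite normcN.
Qed.

End SelfAdjoint.

(** * Hilbert dimension *)

Section HilbertDimension.
Context {R : realType} {H : hilbertType R}.

(** Zorn gives a maximal orthonormal subset of [W]; a nonzero vector of [W] orthogonal to it could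
    be normalised and added. *)
Lemma orthonormal_basis_exists (W : set H) : is_subspace W ->
  exists B, orthonormal_basis W B.
Proof.
move=> sW; pose P (B : set H) := B `<=` W /\
  forall x y, B x -> B y -> '[x, y] = (x == y)%:R.
have [F FP Ftot|B [[BW Bon] Bmax]] := @Zorn_bigcup _ P.
  split=> [x [X FX Xx]|x y [X FX Xx] [Y FY Yy]]; first exact: (FP _ FX).1 _ Xx.
  have [XY|YX] := Ftot _ _ FX FY.
    exact: (FP _ FY).2 (XY _ Xx) Yy.
  exact: (FP _ FX).2 Xx (YX _ Yy).
exists B; split => // x Wx xB; apply: contrapT => x0.
have x1 : hnorm x != 0 by apply/eqP => /hnorm_eq0.
pose u := (hnorm x)^-1%:C *: x.
have uB b : B b -> '[u, b] = 0 by move=> Bb; rewrite hdotZl xB ?mulr0.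
have Bu b : B b -> '[b, u] = 0 by move=> /uB/hdot_eq0C.
have uu : '[u, u] = 1.
  rewrite hdotxx hnormZ normc_real ger0_norm ?invr_ge0 ?hnorm_ge0//.
  by rewrite mulVf// expr1n.
have nBu : ~ B u by move=> /uB/eqP; rewrite uu oner_eq0.
apply: (Bmax (B `|` [set u])).
  by split=> [y By|/(_ u (or_intror erefl))//]; left.
split=> [y [/BW//|->]|y z]; first exact: subspaceZ.
move=> [By|->] [Bz|->]; first exact: Bon.
- rewrite Bu//; case: eqP => // yu; by move: nBu; rewrite -yu.
- rewrite uB//; case: eqP => // uz; by move: nBu; rewrite uz.
- by rewrite uu eqxx.
Qed.

(** A basis of the range of [U] is pulled back along [U] and pushed forward along [V]; equality of
    the pairings preserves orthonormality and maximality. *)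
Lemma isometric_same_hilbert_dim (E : hilbertType R) (U V : E -> H) :
  linear U -> injective U -> injective V ->
  (forall x y, '[U x, U y] = '[V x, V y]) ->
  same_hilbert_dim (range U) (range V).
Proof.
move=> lU Ui Vi UV.
have [U0 _ _ _] := linear_morphE lU.
have sU : is_subspace (range U).
  split=> [|a _ _ [x _ <-] [y _ <-]]; first by exists 0.
  by exists (a *: x + y) => //; rewrite lU.
have [B [BU Bon Bmax]] := orthonormal_basis_exists sU.
pose Z := U @^-1` B.
have BE : B = U @` Z.
  apply/seteqP; split=> [b Bb|_ [z Zz <-]//].
  by have [z _ zb] := BU _ Bb; exists z => //; rewrite /Z /= zb.
exists B, (V @` Z); split => //.
- split=> [_ [z _ <-]|_ _ [x Zx <-] [y Zy <-]|_ [x _ <-] xV].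
  + by exists z.
  + by rewrite -UV Bon// !inj_eq.
  + suff -> : x = 0.
      apply: hdotxx_eq0; rewrite -UV U0 hdot0l//.
    apply: Ui; rewrite U0; apply: Bmax; first by exists x.
    move=> b Bb; have [z _ zb] := BU _ Bb.
    by rewrite -zb UV xV//; exists z => //; rewrite /Z /= zb.
- rewrite BE (card_eq_trans (inj_card_eq _))//; first by move=> ? ? _ _; exact: Ui.
  by rewrite card_eq_sym inj_card_eq// => ? ? _ _; exact: Vi.
Qed.

(** The graph of [A_N] is later written as an intersection of sets of this form. *)
Lemma closed_pairing (a b : H) :
  closed [set p : H * H | '[p.1, a] + '[p.2, b] = 0].
Proof.
move=> p pcl /=; apply: normc_le0 => e e0.
pose K := hnorm a + hnorm b + 1.
have K0 : 0 < K by rewrite /K; have := hnorm_ge0 a; have := hnorm_ge0 b; lra.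
have d0 : 0 < e / K by rewrite divr_gt0.
have [|q [/= q0 [q1 q2]]] := pcl (ball p (e / K)%:C).
  by apply: nbhsx_ballx; rewrite (ltcR 0).
move: q1 q2; rewrite -ball_normE /= !normE !ltcR => /ltW q1 /ltW q2.
have -> : '[p.1, a] + '[p.2, b] = '[p.1 - q.1, a] + '[p.2 - q.2, b].
  by rewrite !hdotBl addrACA -opprD q0 subr0.
rewrite (le_trans (le_normcD _ _))//.
have h1 := cauchy_schwarz (p.1 - q.1) a.
have h2 := cauchy_schwarz (p.2 - q.2) b.
have h3 := ler_wpM2r (hnorm_ge0 a) q1.
have h4 := ler_wpM2r (hnorm_ge0 b) q2.
have : e / K * K = e by rewrite divfK// gt_eqF.
by rewrite {2}/K; lra.
Qed.

End HilbertDimension.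

(** * The boundary triple *)

Section Setting.
Context {R : realType} {H h : hilbertType R} {A : pop H H} {tau : H -> h}.
Hypotheses (A_self_adjoint : self_adjoint A)
    (tau_linear : linear_on (dom A) tau)
    (tau_bounded : graph_bounded A tau)
    (tau_surjective : forall a : h, exists2 x, dom A x & tau x = a)
    (ker_tau_dense : dense (ker_tau A tau)).
Local Notation G := (G_ A tau).
Local Notation Gs := (G_star A tau).
Local Notation S := (A_N A tau).
Local Notation sA := A_self_adjoint.
Implicit Types (z w : R[i]) (x y : H) (zeta eta : h).

Let i_res : resolvent_set A 'i.
Proof. exact: (imaginary_resolvent_i sA).1. Qed.

Let Ni_res : resolvent_set A (- 'i).
Proof. exact: (imaginary_resolvent_i sA).2. Qed.

(** * The operators G(z) and the graph adjoint of tau *)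

Lemma tau_bound : exists2 M : R, 0 <= M &
  forall x, dom A x -> hnorm (tau x) <= M * (hnorm (A x) + hnorm x).
Proof.
(* The constant is complex, but its product with the graph norm dominates a norm, hence is
   nonnegative and equal to its modulus. *)
have [M HM] := tau_bounded; exists (normc M) => [|x Dx]; first exact: normc_ge0.
rewrite -lecR -normE rmorphM/= -[_%:C]/(`|M|).
have g0 : 0 <= graph_norm A x.
  by rewrite sqrtC_ge0 /graph_dot !hdotxx -rmorphD/= ler0c addr_ge0// sqr_ge0.
have tM := HM x Dx.
rewrite (@le_trans _ _ (`|M| * graph_norm A x))//.
  rewrite -[X in _ <= _ * X](ger0_norm g0) -normrM.
  by rewrite (ger0_norm (le_trans (normr_ge0 _) tM)).
rewrite ler_wpM2l//.
have s0 : 0 <= (hnorm (A x) + hnorm x)%:C by rewrite ler0c addr_ge0// hnorm_ge0.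
rewrite -(sqrCK s0) /graph_norm ler_sqrtC ?qualifE/=.
- rewrite /graph_dot !hdotxx -rmorphD/= -rmorphXn/= lecR.
  by have := mulr_ge0 (hnorm_ge0 (A x)) (hnorm_ge0 x); nra.
- by rewrite /graph_dot !hdotxx -rmorphD/= ler0c addr_ge0// sqr_ge0.
- by rewrite exprn_ge0.
Qed.

Lemma tau_resolvent z : resolvent_set A z ->
  linear (tau \o resolvent A z) /\ exists M, bounded_by M (tau \o resolvent A z).
Proof.
move=> /resolventP[/bounded_operatorP[lB [M [M0 BM]]] BR _].
have [_ _ tL] := tau_linear.
split=> [a x y /=|]; first by rewrite lB tL//; [exact: (BR _).1|exact: (BR _).1].
have [K K0 HK] := tau_bound.
(* From A R(z) y = z R(z) y - y, the norm of A R(z) y is at most (1 + |z| M) |y|. *)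
exists (K * ((1 + normc z * M) + M)); split.
  by rewrite mulr_ge0// addr_ge0// addr_ge0// mulr_ge0// normc_ge0.
move=> y /=; have [Dy yE] := BR y.
rewrite (le_trans (HK _ Dy))// -mulrA ler_wpM2l// mulrDl lerD//.
have -> : A (resolvent A z y) = z *: resolvent A z y - y.
  by rewrite -[X in _ = _ - X]yE opprD opprK [RHS]addrC subrK.
rewrite (le_trans (ler_hnormD _ _))// hnorm_opp hnormZ addrC mulrDl mul1r lerD//.
by rewrite -mulrA ler_wpM2l ?normc_ge0.
Qed.

Lemma G_linear z : resolvent_set A z -> linear (G z).
Proof.
move=> /(resolvent_set_conj sA)/tau_resolvent[lB [M BM]].
exact: badjoint_linear lB BM.
Qed.

Lemma G_bounded z : resolvent_set A z -> exists M, bounded_by M (G z).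
Proof.
move=> /(resolvent_set_conj sA)/tau_resolvent[lB [M BM]].
exists M; exact: badjoint_bounded lB BM.
Qed.

(** The adjoint relation defining [G z], evaluated at the vector that the resolvent at the conjugate
    point sends to [x]. *)
Lemma tau_G z x zeta : resolvent_set A z -> dom A x ->
  '[tau x, zeta] = '[- A x + Num.conj z *: x, G z zeta].
Proof.
move=> /(resolvent_set_conj sA) zR Dx.
have [lB [M BM]] := tau_resolvent zR.
by have [_ _ BL] := resolventP zR; rewrite -(badjointP lB BM)/= BL.
Qed.

(** The adjoint form of the first resolvent identity; in particular the difference lies in [dom A].
    Testing against [y] and setting x = R(conj w) y reduces it to [tau_G] at [z] and [w]. *)
Lemma G_diff z w zeta : resolvent_set A z -> resolvent_set A w ->
  G w zeta - G z zeta = (z - w) *: resolvent A w (G z zeta).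
Proof.
move=> zR wR; apply: hdot_extr => y.
have [_ /(_ y)[+ +] _] := resolventP (resolvent_set_conj sA wR).
have [_ /(_ (G z zeta))[+ +] _] := resolventP wR.
move: (resolvent A _ y) (resolvent A w _) => x r Dr rG Dx xy.
have e : '[x, G z zeta] = '[y, r] by rewrite -xy (sa_shift sA) // rG.
have := tau_G zeta wR Dx; rewrite (tau_G zeta zR Dx) xy => yw.
rewrite hdotBr -yw hdotZr rmorphB/= -e -xy -hdotBl opprD addrACA subrr add0r.
by rewrite -scalerBl hdotZl.
Qed.

Definition tau_star zeta := resolvent A 'i (G (- 'i) zeta).

Lemma dom_tau_star zeta : dom A (tau_star zeta).
Proof. by have [_ /(_ (G (- 'i) zeta))[]] := resolventP i_res. Qed.

Lemma G_Ni zeta : G (- 'i) zeta = - A (tau_star zeta) + 'i *: tau_star zeta.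
Proof. by have [_ /(_ (G (- 'i) zeta))[]] := resolventP i_res. Qed.

Lemma G_i zeta : G 'i zeta = - A (tau_star zeta) - 'i *: tau_star zeta.
Proof.
have := G_diff zeta Ni_res i_res; rewrite -/(tau_star zeta) G_Ni => /eqP.
rewrite subr_eq => /eqP ->; rewrite scalerBl scaleNr addrCA; congr (_ + _).
by rewrite subrK.
Qed.

Lemma G_starE zeta : Gs zeta = - A (tau_star zeta).
Proof.
rewrite /G_star G_i G_Ni addrACA addNr addr0 -mulr2n -(scaler_nat _ (- A _)) scalerA.
by rewrite mulVf ?scale1r ?pnatr_eq0.
Qed.

Lemma tau_pairing x zeta : dom A x ->
  '[tau x, zeta] = '[A x, A (tau_star zeta)] + '[x, tau_star zeta].
Proof.
move=> Dx; rewrite (tau_G zeta Ni_res Dx) G_Ni rmorphN/= conjCi opprK.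
rewrite hdotDl !hdotDr !hdotNl !hdotNr !hdotZl !hdotZr conjCi.
rewrite (sa_symmetric sA Dx (dom_tau_star zeta)).
have -> : 'i * (- 'i * '[x, tau_star zeta]) = '[x, tau_star zeta].
  by rewrite mulrA mulrN -expr2 sqrCi opprK mul1r.
by ring.
Qed.

(** By [tau_G], a vector annihilated by [G z] is orthogonal to the range of [tau], which is all of
    [h]. *)
Lemma G_inj z : resolvent_set A z -> injective (G z).
Proof.
move=> zR; have [_ _ _ GB] := linear_morphE (G_linear zR).
move=> zeta eta e; apply/eqP; rewrite -subr_eq0; apply/eqP/hdotxx_eq0.
have [x Dx {1}<-] := tau_surjective (zeta - eta).
by rewrite (tau_G _ zR Dx) GB e subrr hdot0r.
Qed.

Lemma tau_star_linear : linear tau_star.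
Proof.
have [/bounded_operatorP[lB _] _ _] := resolventP i_res.
exact: linear_comp (G_linear Ni_res) lB.
Qed.

Lemma G_star_linear : linear Gs.
Proof.
move=> a zeta eta; rewrite !G_starE tau_star_linear.
have [sD AZ AD _] := sa_linearE sA.
have := subspaceZ a sD (dom_tau_star zeta).
by move=> Da; rewrite AD ?AZ//; [rewrite opprD scalerN|exact: dom_tau_star..].
Qed.

(** * The adjoint of the restriction and the uniqueness of the decomposition *)

Lemma dom_A_N x : dom S x <-> dom A x /\ tau x = 0.
Proof. by split=> [[_ []]|[]]. Qed.

Lemma A_N_dense : densely_defined S.
Proof.
rewrite /densely_defined (_ : dom S = ker_tau A tau)//.
by apply/seteqP; split => x /dom_A_N.
Qed.

Lemma A_N_adjoint_value phi zeta : dom A phi ->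
  is_adjoint_value S (phi + Gs zeta) (A phi + tau_star zeta).
Proof.
move=> Dphi x /dom_A_N[Dx tx]; rewrite /= !hdotDr (sa_symmetric sA Dx Dphi).
congr (_ + _); have := tau_pairing zeta Dx; rewrite tx hdot0l G_starE hdotNr.
by move=> /esym/eqP; rewrite addr_eq0 => /eqP ->; rewrite opprK.
Qed.

Lemma adjoint_A_N phi zeta : dom A phi ->
  adjoint S (phi + Gs zeta) = A phi + tau_star zeta.
Proof. by move=> Dphi; apply: (adjoint_eq A_N_dense); exact: A_N_adjoint_value. Qed.

Lemma dom_adjoint_A_N : dom (adjoint S) =
  [set phi | exists phi_star zeta, dom A phi_star /\ phi = phi_star + Gs zeta].
Proof.
apply/seteqP; split=> [phi /adjointP|_ [phi [zeta [Dphi ->]]]]; last first.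
  by exists (A phi + tau_star zeta); exact: A_N_adjoint_value.
set u := adjoint S phi => phiu.
have [sD _ _ _] := sa_linearE sA.
have [_ /(_ ('i *: phi - u))[Dphi0 phi0E] _] := resolventP i_res.
set phi0 := resolvent A 'i _ in Dphi0 phi0E.
have iR' := resolvent_set_conj sA i_res.
have [lB [M BM]] := tau_resolvent iR'.
have [_ BR BL] := resolventP iR'.
(* A vector y in the kernel of tau R(conj i) is the shift of some x in [dom S]; the equation for
   [phi0] and the adjoint relation for [phi] then make <y, phi - phi0> vanish. *)
have [zeta zetaE] : exists zeta, phi - phi0 = G 'i zeta.
  apply: (ker_orth_badjoint lB BM) => [a|y /= y0].
    have [x Dx <-] := tau_surjective a.
    by exists (- A x + Num.conj 'i *: x); rewrite /= BL.
  have [Dx xE] := BR y; set x := resolvent A _ y in y0 Dx xE.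
  rewrite -xE hdotBr (sa_shift sA _ Dx Dphi0) phi0E hdotDl hdotNl hdotZl.
  have -> : '[A x, phi] = '[x, u] by apply: phiu; apply/dom_A_N.
  by rewrite hdotBr hdotZr; ring.
(* G(i) differs from [Gs] by [- 'i *: tau_star zeta], which is absorbed into the component in
   [dom A]. *)
exists (phi0 - 'i *: tau_star zeta), zeta; split.
  by apply: subspaceB => //; apply: subspaceZ => //; exact: dom_tau_star.
by rewrite -addrA [X in _ + X]addrC G_starE -G_i -zetaE addrC subrK.
Qed.

(** With t = [tau_star zeta], the adjoint of [S] sends [Gs zeta] = - A t both to t and to - A (A t).
    Hence |t|^2 = - |A t|^2, so t = 0, and by [tau_pairing] [zeta] is orthogonal to the range of
    [tau]. *)
Lemma G_star_dom_eq0 zeta : dom A (Gs zeta) -> zeta = 0.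
Proof.
move=> D; have [sD AZ AD AB] := sa_linearE sA.
have A0 : A 0 = 0 by rewrite -(scale0r 0) AZ ?scale0r//; exact: sD.1.
have e : tau_star zeta = A (Gs zeta).
  apply: (adjoint_value_uniq (y := Gs zeta) A_N_dense).
    by have := A_N_adjoint_value zeta sD.1; rewrite !add0r A0 add0r.
  by move=> x /dom_A_N[Dx _]; exact: (sa_symmetric sA).
have r0 : tau_star zeta = 0.
  apply: hnorm_eq0; apply/eqP; rewrite -sqrf_eq0; apply/eqP.
  have : '[tau_star zeta, tau_star zeta] = - '[A (tau_star zeta), A (tau_star zeta)].
    by rewrite {1}e (sa_symmetric sA D (dom_tau_star zeta)) G_starE hdotNl.
  rewrite !hdotxx -rmorphN => /complexI.
  have := sqr_ge0 (hnorm (tau_star zeta)).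
  by have := sqr_ge0 (hnorm (A (tau_star zeta))); lra.
apply: hdotxx_eq0; have [x Dx {1}<-] := tau_surjective zeta.
by rewrite tau_pairing// r0 A0 !hdot0r addr0.
Qed.

Lemma zeta_partE phi zeta : dom A phi ->
  zeta_part A tau (phi + Gs zeta) = zeta.
Proof.
move=> Dphi; have [sD _ _ _] := sa_linearE sA.
have [_ _ _ GB] := linear_morphE G_star_linear.
rewrite /zeta_part.
have : [set z | dom A (phi + Gs zeta - Gs z)] zeta by rewrite /= addrK.
move=> /(@xgetI _ 0) /=; set z := xget _ _ => Dz.
apply/eqP; rewrite eq_sym -subr_eq0; apply/eqP/G_star_dom_eq0; rewrite GB.
have -> : Gs zeta - Gs z = phi + Gs zeta - Gs z - phi.
  by rewrite [RHS]addrC -addrA addKr.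
exact: subspaceB.
Qed.

(** * Boundary maps, the Green identity and closedness *)

Lemma gamma2E phi zeta : dom A phi -> gamma2 A tau (phi + Gs zeta) = zeta.
Proof. exact: zeta_partE. Qed.

Lemma gamma1E phi zeta : dom A phi ->
  gamma1 A tau (phi + Gs zeta) = - tau phi.
Proof. by move=> Dphi; rewrite /gamma1 /star_part zeta_partE// addrK. Qed.

Lemma green phi psi : dom (adjoint S) phi -> dom (adjoint S) psi ->
  '[adjoint S phi, psi] - '[phi, adjoint S psi]
  = '[gamma1 A tau phi, gamma2 A tau psi] - '[gamma2 A tau phi, gamma1 A tau psi].
Proof.
rewrite dom_adjoint_A_N => -[{}phi [zeta [Dphi ->]]] [{}psi [eta [Dpsi ->]]].
rewrite !adjoint_A_N// !gamma1E// !gamma2E// !G_starE hdotNl hdotNr.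
(* The boundary pairings become graph inner products; the remaining terms <A phi, psi> and <tau_star
   zeta, A tau_star eta> cancel by symmetry. *)
rewrite (hdotC zeta) !tau_pairing// rmorphD/= -!hdotC.
rewrite !(hdotDl, hdotDr, hdotNl, hdotNr) (sa_symmetric sA Dphi Dpsi).
rewrite (sa_symmetric sA (dom_tau_star zeta) (dom_tau_star eta)).
by ring.
Qed.

Lemma A_N_linear : linear_op S.
Proof.
have [tS tZ tD tB] := linear_onE tau_linear.
have [A0 AD AL] : linear_on (dom A) A by case: sA.
split.
- by apply/dom_A_N; split => //; rewrite -(scale0r 0) tZ// scale0r.
- move=> a x y /dom_A_N[Dx tx] /dom_A_N[Dy ty]; apply/dom_A_N; split.
    exact: AD.
  by have [_ _ ->//] := tau_linear; rewrite tx ty scaler0 addr0.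
- by move=> a x y /dom_A_N[Dx tx] /dom_A_N[Dy ty]; exact: AL.
Qed.

Lemma A_N_symmetric : symmetric_op S.
Proof. by move=> x y /dom_A_N[Dx _] /dom_A_N[Dy _]; exact: (sa_symmetric sA). Qed.

(** The first family of closed conditions says that (x, u) solves the weak equation of [A], so u = A
    x by maximality. The second then says, by [tau_pairing], that [tau x] is orthogonal to every
    [zeta]. *)
Lemma A_N_closed : closed_op S.
Proof.
rewrite /closed_op.
have -> : [set p : H * H | dom S p.1 /\ p.2 = S p.1] =
    (\bigcap_(x in dom A) [set p | '[p.1, A x] + '[p.2, - x] = 0]) `&`
    (\bigcap_zeta [set p | '[p.1, tau_star zeta] + '[p.2, A (tau_star zeta)] = 0]).
  apply/seteqP; split=> [[x u] /= [/dom_A_N[Dx tx] ->]|[x u] /= [Ax tx]].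
    split=> [y Dy|zeta _] /=; rewrite ?hdotNr.
      by rewrite (sa_symmetric sA)// subrr.
    by rewrite addrC -tau_pairing// tx hdot0l.
  have [|Dx Axu] := sa_maximal sA (x := x) (u := u).
    move=> y Dy; have /eqP := Ax y Dy; rewrite /= hdotNr subr_eq0 => /eqP.
    by move=> /(congr1 Num.conj); rewrite -!hdotC.
  rewrite -Axu in tx *; split => //; apply/dom_A_N; split => //.
  apply: hdot_extl => zeta; rewrite hdot0l tau_pairing// addrC.
  exact: tx.
by apply: closedI; apply: closed_bigI => *; exact: closed_pairing.
Qed.

(** * Defect spaces and the Weyl function *)

Lemma G_split z zeta : resolvent_set A z ->
  let d := ('i - z) *: resolvent A z (G 'i zeta) - 'i *: tau_star zeta in
  dom A d /\ G z zeta = d + Gs zeta.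
Proof.
move=> zR d; have [sD _ _ _] := sa_linearE sA.
have [_ /(_ (G 'i zeta))[Dr _] _] := resolventP zR.
split.
  by apply: subspaceB => //; apply: subspaceZ => //; exact: dom_tau_star.
(* [G_diff] moves from G(i) to G(z), and G(i) is [Gs] minus ['i *: tau_star zeta]. *)
by rewrite /d -G_diff// G_starE -addrA [X in _ + X]addrC -G_i subrK.
Qed.

Lemma G_kernel z zeta : resolvent_set A z -> kernel_at (adjoint S) z (G z zeta).
Proof.
move=> zR; have [Dd dE] := G_split zeta zR; split.
  by rewrite dom_adjoint_A_N; eexists; exists zeta; split; [exact: Dd|].
rewrite (@adjoint_eq _ _ _ _ (z *: G z zeta) A_N_dense) ?addNr//.
move=> x /dom_A_N[Dx tx].
have := tau_G zeta zR Dx; rewrite tx hdot0l hdotDl hdotNl hdotZl hdotZr.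
by move=> /esym/eqP; rewrite addrC subr_eq0 => /eqP.
Qed.

(** Two kernel vectors with the same [zeta] differ by an element of [dom A] annihilated by the shift
    of [A] at [z], which is zero. *)
Lemma kernel_split z phi zeta : resolvent_set A z -> dom A phi ->
  kernel_at (adjoint S) z (phi + Gs zeta) -> phi + Gs zeta = G z zeta.
Proof.
move=> zR Dphi [_ +]; have [_ +] := G_kernel zeta zR.
have [Dd ->] := G_split zeta zR.
move: (_ - 'i *: _) Dd => d Dd; rewrite !adjoint_A_N// => e2 e1.
have [sD _ _ AB] := sa_linearE sA.
have [/bounded_operatorP[/linear_morphE[B0 _ _ _] _] _ BL] := resolventP zR.
congr (_ + _); apply/eqP; rewrite -subr_eq0; apply/eqP.
rewrite -(BL (phi - d)); last exact: subspaceB.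
rewrite -B0; congr (resolvent A z _); rewrite AB//.
have addrDK (u v w : H) : u + w - (v + w) = u - v.
  by rewrite opprD addrACA subrr addr0.
have := congr2 (fun u v => u - v) e1 e2; rewrite subrr /= => <-.
by rewrite (opprD (- (A d + _))) addrACA -scalerBr -opprD !addrDK.
Qed.

(** Boundedness is visible in this form: [tau] occurs only composed with resolvents. *)
Lemma weyl_tauE z zeta : resolvent_set A z ->
  weyl_tau A tau z zeta =
  (z - 'i) *: (tau \o resolvent A z) (G 'i zeta) +
  'i *: (tau \o resolvent A 'i) (G (- 'i) zeta).
Proof.
move=> zR; have [_ dE] := G_split zeta zR.
have [sD tZ tD _] := linear_onE tau_linear.
have [_ /(_ (G 'i zeta))[Dr _] _] := resolventP zR.
rewrite /weyl_tau dE opprD addrCA subrr addr0 opprB -scaleNr opprB addrC.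
have Dir := dom_tau_star zeta.
rewrite tD; [|exact: subspaceZ..].
by rewrite !tZ.
Qed.

Lemma gamma1_G z zeta : resolvent_set A z ->
  gamma1 A tau (G z zeta) = weyl_tau A tau z zeta.
Proof.
move=> zR; have [Dd dE] := G_split zeta zR.
rewrite /weyl_tau dE gamma1E// opprD addrCA subrr addr0.
have [sD tZ _ _] := linear_onE tau_linear.
by rewrite -[in RHS]scaleN1r tZ// scaleN1r.
Qed.

Lemma gamma2_G z zeta : resolvent_set A z -> gamma2 A tau (G z zeta) = zeta.
Proof. by move=> zR; have [Dd ->] := G_split zeta zR; rewrite gamma2E. Qed.

Lemma kernel_adjoint z phi : resolvent_set A z ->
  kernel_at (adjoint S) z phi <-> exists zeta, phi = G z zeta.
Proof.
move=> zR; split=> [k|[zeta ->]]; last exact: G_kernel.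
have [+ _] := k; rewrite dom_adjoint_A_N => -[phi' [zeta [Dphi e]]].
by exists zeta; rewrite e in k *; exact: kernel_split.
Qed.

Lemma A_N_defect : equal_defect_indices S.
Proof.
rewrite /equal_defect_indices.
have kE z : resolvent_set A z -> kernel_at (adjoint S) z = range (G z).
  move=> zR; apply/seteqP; split=> [phi|_ [zeta _ <-]]; last exact: G_kernel.
  by move=> /(kernel_adjoint _ zR)[zeta ->]; exists zeta.
rewrite !kE//; apply: isometric_same_hilbert_dim.
- exact: G_linear.
- exact: G_inj.
- exact: G_inj.
(* Both inner products reduce to the graph inner product of [tau_star zeta] and [tau_star eta], the
   cross terms cancelling by symmetry. *)
- move=> zeta eta; rewrite !G_i !G_Ni.
  rewrite !(hdotDl, hdotDr, hdotNl, hdotNr, hdotZl, hdotZr).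
  by rewrite (sa_symmetric sA (dom_tau_star zeta) (dom_tau_star eta)) conjCi; ring.
Qed.

Lemma weyl_tau_bounded z : resolvent_set A z -> bounded_operator (weyl_tau A tau z).
Proof.
move=> zR.
have -> : weyl_tau A tau z = fun zeta =>
    (z - 'i) *: ((tau \o resolvent A z) \o G 'i) zeta +
    'i *: ((tau \o resolvent A 'i) \o G (- 'i)) zeta.
  by apply/funext => zeta; exact: weyl_tauE.
have [lB [M BM]] := tau_resolvent zR; have [lC [N CN]] := tau_resolvent i_res.
have [M' GM] := G_bounded i_res; have [N' GN] := G_bounded Ni_res.
apply/bounded_operatorP; split.
  by apply: linear_lincomb; apply: linear_comp => //; exact: G_linear.
by eexists; apply: bounded_by_lincomb; apply: bounded_by_comp; eassumption.
Qed.

Lemma triple_extension_A : op_eq (triple_extension S (gamma2 A tau)) A.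
Proof.
have Gs0 : Gs 0 = 0 by have [] := linear_morphE G_star_linear.
have r0 : tau_star 0 = 0 by have [] := linear_morphE tau_star_linear.
have sub phi : dom A phi -> phi = phi + Gs 0 by rewrite Gs0 addr0.
have DE : dom (triple_extension S (gamma2 A tau)) = dom A.
  rewrite /triple_extension /restrict /= -/(dom (adjoint S)) dom_adjoint_A_N.
  apply/seteqP; split=> [_ [[phi [zeta [Dphi ->]]]]|phi Dphi].
    by rewrite /= gamma2E// => ->; rewrite Gs0 addr0.
  split; first by exists phi, 0; split=> //; exact: sub.
  by rewrite /= {1}(sub _ Dphi) gamma2E.
split => // x; rewrite DE => Dx.
by have := adjoint_A_N 0 Dx; rewrite r0 addr0 -sub.
Qed.

Lemma gamma2_linear : linear_on (dom (adjoint S)) (gamma2 A tau).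
Proof.
have [D0 DL _] := adjoint_linear_on A_N_dense.
have [sD _ _ _] := sa_linearE sA.
split=> // a x y; rewrite dom_adjoint_A_N.
move=> -[phi [zeta [Dphi ->]]] [psi [eta [Dpsi ->]]].
by rewrite scalerDr addrACA -G_star_linear !gamma2E//; exact: sD.2.
Qed.

Lemma gamma1_linear : linear_on (dom (adjoint S)) (gamma1 A tau).
Proof.
have [D0 DL _] := gamma2_linear; have [sD _ _ _] := sa_linearE sA.
split=> // a x y; rewrite dom_adjoint_A_N.
move=> -[phi [zeta [Dphi ->]]] [psi [eta [Dpsi ->]]].
have [_ _ tL] := tau_linear.
rewrite scalerDr addrACA -G_star_linear !gamma1E//; last exact: sD.2.
by rewrite tL// opprD scalerN.
Qed.

Lemma A_N_boundary_triple : boundary_triple S (gamma1 A tau) (gamma2 A tau).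
Proof.
split.
- by split; [exact: A_N_linear|exact: A_N_dense|exact: A_N_closed
            |exact: A_N_symmetric|exact: A_N_defect].
- by split; [exact: gamma1_linear|exact: gamma2_linear].
(* The preimage of [- a] compensates the sign in [gamma1]. *)
- move=> a b; have [x Dx xa] := tau_surjective (- a).
  exists (x + Gs b); rewrite gamma1E// gamma2E// xa opprK; split => //.
  by rewrite dom_adjoint_A_N; exists x, b.
- exact: green.
Qed.

(** All kernel vectors have the form [G z zeta], with boundary values [weyl_tau A tau z zeta] and
    [zeta]. As [zeta] ranges over all of [h], the values of any competitor are determined. *)
Lemma weyl_tau_is_weyl :
  is_weyl_function S (gamma1 A tau) (gamma2 A tau) (weyl_tau A tau).
Proof.
rewrite /is_weyl_function /weyl_property (op_eq_resolvent_set triple_extension_A).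
split=> [z zR|Gamma' Gw z zR].
  split; first exact: weyl_tau_bounded.
  by move=> phi /(kernel_adjoint _ zR)[zeta ->]; rewrite gamma1_G// gamma2_G.
apply/funext => zeta; have [_ /(_ _ (G_kernel zeta zR))] := Gw z zR.
by rewrite gamma1_G// gamma2_G.
Qed.

End Setting.

Theorem theorem3p1 (R : realType) (H h : hilbertType R)
    (A : pop H H) (tau : H -> h)
    (A_self_adjoint : self_adjoint A)
    (tau_linear : linear_on (dom A) tau)
    (tau_bounded : graph_bounded A tau)
    (tau_surjective : forall a : h, exists2 x, dom A x & tau x = a)
    (ker_tau_dense : dense (ker_tau A tau)) :
  (* (1) the adjoint of A_N *)
  [/\ dom (adjoint (A_N A tau)) =
        [set phi | exists phi_star zeta,
           dom A phi_star /\ phi = phi_star + G_star A tau zeta]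
    & forall phi_star zeta, dom A phi_star ->
        adjoint (A_N A tau) (phi_star + G_star A tau zeta)
        = A phi_star + resolvent A 'i (G_ A tau (- 'i) zeta)]
  /\
  (* (2) the maps gamma1, gamma2 and the boundary triple *)
  [/\ forall phi_star zeta, dom A phi_star ->
        gamma1 A tau (phi_star + G_star A tau zeta) = - tau phi_star /\
        gamma2 A tau (phi_star + G_star A tau zeta) = zeta
    & boundary_triple (A_N A tau) (gamma1 A tau) (gamma2 A tau)]
  /\
  (* (3) the Weyl function, whose domain is the resolvent set of A *)
  [/\ op_eq (triple_extension (A_N A tau) (gamma2 A tau)) A
    & is_weyl_function (A_N A tau) (gamma1 A tau) (gamma2 A tau)
        (weyl_tau A tau)].
Proof.
split; [split|split; split].
- exact: dom_adjoint_A_N.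
- by move=> phi zeta Dphi; exact: adjoint_A_N.
- by move=> phi zeta Dphi; split; [exact: gamma1E|exact: gamma2E].
- exact: A_N_boundary_triple.
- exact: triple_extension_A.
- exact: weyl_tau_is_weyl.
Qed.
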